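(* Let $R$ be a commutative ring with identity and let $M$ be a finitely generated faithful coreduced comultiplication $R$-module. Then $\mathfrak{S}_{IM}=\mathrm{sec}(IM)=IM$ for each ideal $I$ of $R$.
   Context: For a submodule $N$ of $M$, $r\in R$ and an ideal $I$ of $R$: $(N:_M I)=\{m\in M: Im\subseteq N\}$, $(N:_M r)=\{m\in M: rm\in N\}$. $M$ is a comultiplication module if for every submodule $N$ of $M$ there is an ideal $I$ of $R$ with $N=(0:_M I)$. A proper submodule $N$ of $M$ is completely irreducible if $N=\bigcap_{i\in I}N_i$, for a family $\{N_i\}_{i\in I}$ of submodules of $M$, implies $N=N_i$ for some $i$. $M$ is coreduced if for every $r\in R$ and every completely irreducible submodule $L$ of $M$, $(L:_M r)=M$ implies $L+(0:_M r)=M$. A non-zero submodule $N$ of $M$ is second if for each $a\in R$ the multiplication map $N\xrightarrow{a}N$ is either surjective or zero. A second submodule $N$ of $M$ is a maximal second submodule of $M$ if there is no second submodule $L$ of $M$ with $N\subsetneq L\subseteq M$. For a submodule $K$ of $M$, $\mathfrak{S}_K$ is the sum of all maximal second submodules of $M$ contained in $K$ (zero if there are none), and $\mathrm{sec}(K)$ is the sum of all second submodules of $M$ contained in $K$ (zero if there are none). *)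

(* Defs.v *)
From mathcomp Require Import all_boot all_algebra.
From mathcomp Require Import mathcomp_extra boolp classical_sets functions.

Set Implicit Arguments.
Unset Strict Implicit.
Unset Printing Implicit Defensive.

Import GRing.Theory.
Local Open Scope ring_scope.
Local Open Scope classical_set_scope.

(* Rings are [comPzRingType], so that the zero ring is not excluded. *)

Definition submodule (R : comPzRingType) (M : lmodType R) (N : set M) : Prop :=
  GRing.submod_closed (mem N).

Definition ideal (R : comPzRingType) (I : set R) : Prop :=
  submodule (I : set R^o).

Definition finite_sums (V : zmodType) (A : set V) : set V :=
  [set \sum_(x <- s) x | s in [set s : seq V | [set` s] `<=` A]].

(* The sum of the empty family is zero. *)
Definition sum_submodules (V : zmodType) (F : set (set V)) : set V :=
  finite_sums (\bigcup_(N in F) N).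

Section Module.
Variables (R : comPzRingType) (M : lmodType R).
Implicit Types (I : set R) (r a : R) (N L K : set M).

Definition ideal_mul I : set M := finite_sums [set a *: m | a in I & m in setT].

Definition finitely_generated : Prop :=
  exists s : seq M,
    forall m : M, exists c : 'I_(size s) -> R, m = \sum_(i < size s) c i *: s`_i.

Definition faithful : Prop :=
  forall r, (forall m : M, r *: m = 0) -> r = 0.

Definition colon_ideal N I : set M := [set m | forall a, I a -> N (a *: m)].

Definition colon_elt N r : set M := [set m | N (r *: m)].

Definition comultiplication : Prop :=
  forall N, submodule N -> exists2 I, ideal I & N = colon_ideal [set 0] I.

Definition completely_irreducible N : Prop :=
  [/\ submodule N, N <> setT &
      forall (J : Type) (F : J -> set M), (forall j, submodule (F j)) ->
        N = \bigcap_j F j -> exists j, N = F j].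

Definition coreduced : Prop :=
  forall r L, completely_irreducible L -> colon_elt L r = setT ->
    [set x + y | x in L & y in colon_elt [set 0] r] = setT.

Definition second N : Prop :=
  [/\ submodule N, N <> [set 0] &
      forall a, set_surj N N ( *:%R a) \/ (forall x, N x -> a *: x = 0)].

Definition maximal_second N : Prop :=
  second N /\ ~ (exists2 L, second L & N `<` L).

Definition max_sec K : set M :=
  sum_submodules [set N | maximal_second N /\ N `<=` K].

Definition sec K : set M :=
  sum_submodules [set N | second N /\ N `<=` K].

End Module.

Arguments finitely_generated {R} M.
Arguments faithful {R} M.
Arguments comultiplication {R} M.
Arguments coreduced {R} M.
Arguments ideal_mul {R} M I.

(* Main.v *)
Require Import Defs.
From mathcomp Require Import all_boot all_algebra.
From mathcomp Require Import classical_sets.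
From mathcomp Require Import boolp functions.
From mathcomp Require Import ring.

Set Implicit Arguments.
Unset Strict Implicit.
Unset Printing Implicit Defensive.

Import GRing.Theory.
Local Open Scope ring_scope.
Local Open Scope classical_set_scope.

(** The hypotheses force [R] to be a von Neumann regular ring in which every
maximal ideal has a nonzero annihilator, so that every [R]-module is semisimple;
and over such a ring the second submodules of [M] are maximal second.

Regularity comes from coreducedness.  Enough completely irreducible submodules
exist (those maximal among the submodules avoiding a given element) to deduce that
[r *: M = r * r *: M] for all [r]: this is [coreduced_scale_sqr].  As [r *: M] is
finitely generated, [nakayama] turns the equality of modules into [r = r * r * s],
first as operators on [M], then in [R] because [M] is faithful.

Let [m] be a maximal ideal.  By [nakayama] again [m *: M] is proper; being the
submodule killed by some ideal, it is killed by some [r <> 0], and then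
[r * m = 0] with [r] outside [m] ([proper_ideal_annihilator]).  So for every [x]
the module generated by [r *: x] is a vector space over [R / m]; it is zero or
second.  In a submodule [K], the ideal of scalars sending [x] into [sec K] therefore
lies in no maximal ideal, which gives [sec K = K] ([sec_id]).

Finally, when a second module [N] lies in a second module [L], regularity shows
that both have the same annihilator, and in a comultiplication module the
annihilator determines the submodule ([second_maximal_second]); hence the two
sums over second and over maximal second submodules have the same terms. *)

(** * Submodules as sets *)

Section Submodules.
Variables (R : comPzRingType) (M : lmodType R).
Implicit Types (N L K A : set M) (x y : M) (a b r : R).

Lemma submoduleP N :
  submodule N <-> [/\ N 0, forall x y, N x -> N y -> N (x + y)
                    & forall a x, N x -> N (a *: x)].
Proof.
have mE x : (x \in mem N) = (x \in N) by [].
split=> [[N0 Nl]|[N0 ND NZ]].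
  have {}N0 : N 0 by move: N0; rewrite mE inE.
  have {}Nl a x y : N x -> N y -> N (a *: x + y).
    by move=> Nx Ny; have := Nl a x y; rewrite !mE !inE; apply.
  split=> // [x y Nx Ny|a x Nx]; first by rewrite -[x]scale1r; apply: Nl.
  by rewrite -[_ *: _]addr0; apply: Nl.
split; first by rewrite mE inE.
by move=> a x y; rewrite !mE !inE => Nx Ny; apply: ND => //; apply: NZ.
Qed.

Lemma submodule0 N : submodule N -> N 0.
Proof. by case/submoduleP. Qed.

Lemma submoduleD N x y : submodule N -> N x -> N y -> N (x + y).
Proof. by case/submoduleP=> _ + _; apply. Qed.

Lemma submoduleZ N a x : submodule N -> N x -> N (a *: x).
Proof. by case/submoduleP=> _ _; apply. Qed.

Lemma finite_sums_gen A : A `<=` finite_sums A.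
Proof.
move=> x Ax; exists [:: x]; last by rewrite big_seq1.
by move=> y /=; rewrite inE => /eqP ->.
Qed.

Lemma finite_sums_min A K : submodule K -> A `<=` K -> finite_sums A `<=` K.
Proof.
move=> sK AK _ [s /= sA <-]; rewrite big_seq.
elim/big_ind: _; [exact: submodule0 | by move=> *; exact: submoduleD |].
by move=> x xs; apply: AK; apply: sA.
Qed.

Lemma finite_sums_submodule A :
  (forall a x, A x -> A (a *: x)) -> submodule (finite_sums A).
Proof.
move=> AZ; apply/submoduleP; split.
- by exists [::]; last rewrite big_nil.
- move=> _ _ [s /= sA <-] [t /= tA <-]; exists (s ++ t); last by rewrite big_cat.
  by move=> x /=; rewrite mem_cat => /orP[/sA|/tA].
- move=> a _ [s /= sA <-]; exists [seq a *: x | x <- s].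
    by move=> _ /= /mapP[x /sA Ax ->]; apply: AZ.
  by rewrite big_map scaler_sumr.
Qed.

Lemma sec_submodule K : submodule (sec K).
Proof.
apply: finite_sums_submodule => a x [N [sN NK] Nx]; exists N => //.
by apply: submoduleZ => //; case: sN.
Qed.

Lemma colon_elt_submodule N r : submodule N -> submodule (colon_elt N r).
Proof.
move=> sN; apply/submoduleP; split; rewrite /colon_elt /=.
- by rewrite scaler0; apply: submodule0.
- by move=> x y Nx Ny; rewrite scalerDr; apply: submoduleD.
- by move=> a x Nx; rewrite scalerA mulrC -scalerA; apply: submoduleZ.
Qed.

Lemma cyclic_submodule x : submodule (range ( *:%R^~ x)).
Proof.
apply/submoduleP; split.
- by exists 0; rewrite // scale0r.
- by move=> _ _ [a _ <-] [b _ <-]; exists (a + b); rewrite // scalerDl.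
- by move=> a _ [b _ <-]; exists (a * b); rewrite // scalerA.
Qed.

Lemma add_submodule N L : submodule N -> submodule L ->
  submodule [set y + z | y in N & z in L].
Proof.
move=> sN sL; apply/submoduleP; split.
- by exists 0; [exact: submodule0 | exists 0; [exact: submodule0 | rewrite addr0]].
- move=> _ _ [y Ny [z Lz <-]] [y' Ny' [z' Lz' <-]].
  exists (y + y'); first exact: submoduleD.
  by exists (z + z'); [exact: submoduleD | rewrite addrACA].
- move=> a _ [y Ny [z Lz <-]]; exists (a *: y); first exact: submoduleZ.
  by exists (a *: z); [exact: submoduleZ | rewrite scalerDr].
Qed.

End Submodules.

Section Ideals.
Variables (R : comPzRingType) (I : set R).
Hypothesis sI : ideal I.
Implicit Types a b : R.

Lemma ideal0 : I 0.
Proof. exact: (submodule0 sI). Qed.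

Lemma idealD a b : I a -> I b -> I (a + b).
Proof. exact: (submoduleD sI). Qed.

Lemma idealM a b : I b -> I (a * b).
Proof. exact: (@submoduleZ R R^o I a b sI). Qed.

Lemma ideal_mul_submodule (M : lmodType R) : submodule (ideal_mul M I).
Proof.
apply: finite_sums_submodule => a _ [b Ib [x _ <-]].
exists (a * b); first exact: idealM.
by exists x => //; rewrite scalerA.
Qed.

End Ideals.

(** * Submodules maximal among those avoiding an element *)

Section Avoiding.
Variables (R : comPzRingType) (M : lmodType R).
Implicit Types (N L K : set M) (x y : M) (a r : R).

(** For [x = 1] in the module [R] over itself, these are the maximal ideals. *)
Definition maximal_avoiding x L : Prop :=
  [/\ submodule L, ~ L x &
      forall K, submodule K -> L `<=` K -> ~ K x -> K `<=` L].

Lemma exists_maximal_avoiding N x : submodule N -> ~ N x ->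
  exists2 L, N `<=` L & maximal_avoiding x L.
Proof.
move=> sN Nx.
(* The empty set is admitted because the empty chain has an empty union. *)
pose P (X : set M) := X = set0 \/ [/\ submodule X, N `<=` X & ~ X x].
have [] := @Zorn_bigcup M P.
  move=> F FP Ftot; have [[X [FX X0]]|Fempty] :=
      pselect (exists X, F X /\ X <> set0); last first.
    left; apply/seteqP; split=> // y [X FX Xy].
    by apply: Fempty; exists X; split=> // X0; rewrite X0 in Xy.
  have FS Y y : F Y -> Y y -> [/\ submodule Y, N `<=` Y & ~ Y x].
    by move=> FY Yy; case: (FP _ FY) => // Y0; rewrite Y0 in Yy.
  have [y Xy] : X !=set0 by apply/set0P/eqP.
  have [sX NX _] := FS _ _ FX Xy.
  right; split; last by move=> [Y FY Yx]; have [] := FS _ _ FY Yx.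
  - apply/submoduleP; split; first by exists X => //; apply: submodule0.
    + move=> u v [Y FY Yu] [Z FZ Zv].
      have [sY _ _] := FS _ _ FY Yu; have [sZ _ _] := FS _ _ FZ Zv.
      have [YZ|ZY] := Ftot _ _ FY FZ.
        by exists Z => //; apply: submoduleD => //; apply: YZ.
      by exists Y => //; apply: submoduleD => //; apply: ZY.
    + move=> a u [Y FY Yu]; exists Y => //; apply: submoduleZ => //.
      by have [] := FS _ _ FY Yu.
  - by move=> u Nu; exists X => //; apply: NX.
move=> L [PL maxL]; have {PL} : L = set0 \/ _ := PL.
case=> [L0|[sL NL Lx]].
  case: (maxL N); last by right; split.
  by rewrite L0; split=> // /(_ 0 (submodule0 sN)).
exists L => //; split=> // K sK LK Kx; apply: contrapT => KL.
by apply: (maxL K); [split | right; split=> //; apply: subset_trans LK].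
Qed.

(** A member of the family that avoids [x] contains [L], hence equals it. *)
Lemma maximal_avoiding_completely_irreducible x L :
  maximal_avoiding x L -> completely_irreducible L.
Proof.
move=> [sL Lx maxL]; split=> // [LT|J F sF LE]; first by apply: Lx; rewrite LT.
have [j Fjx] : exists j, ~ F j x.
  apply: contrapT => FxN; apply: Lx; rewrite LE => j _.
  by apply: contrapT => Fjx; apply: FxN; exists j.
exists j; have LF : L `<=` F j by rewrite LE => y /(_ j I).
by apply/seteqP; split=> //; apply: maxL.
Qed.

(** Multiplication by [r] embeds the quotient of [M] by the residual of [L] into
the quotient of [M] by [L], so essentiality of the image of [r *: x] pulls back
to essentiality of the image of [x]. *)
Lemma maximal_avoiding_colon_elt r x L :
  maximal_avoiding (r *: x) L -> maximal_avoiding x (colon_elt L r).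
Proof.
move=> [sL Lx maxL]; split=> //; first exact: colon_elt_submodule.
move=> K sK LK Kx p Kp; apply: contrapT => Lp.
pose P := [set y + z | y in L & z in range ( *:%R^~ (r *: p))].
have sP : submodule P by apply: add_submodule => //; apply: cyclic_submodule.
have LP : L `<=` P.
  move=> y Ly; exists y => //; exists 0; last by rewrite addr0.
  by exists 0; rewrite // scale0r.
have [[y Ly [_ [c _ <-] yE]]|Px] := pselect (P (r *: x)).
  apply: Kx; rewrite -[x](subrK (c *: p)); apply: submoduleD => //.
    by apply: LK; rewrite /colon_elt /= scalerBr -yE !scalerA mulrC addrK.
  exact: submoduleZ.
apply: Lp; apply: (maxL P) => //.
exists 0; first exact: submodule0.
exists (r *: p); last by rewrite add0r.
by exists 1; rewrite // scale1r.
Qed.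

End Avoiding.

(** * Nakayama's lemma *)

Section Nakayama.
Variables (R : comPzRingType) (M : lmodType R).

Fixpoint span (s : seq M) : set M :=
  if s is x :: s' then [set a *: x + y | a in setT & y in span s'] else [set 0].

Lemma span_submodule s : submodule (span s).
Proof.
elim: s => [|x s IHs] /=.
  apply/submoduleP; split=> //=; first by move=> x y -> ->; rewrite addr0.
  by move=> a x ->; rewrite scaler0.
suff -> : [set a *: x + y | a in setT & y in span s]
    = [set z + y | z in range ( *:%R^~ x) & y in span s].
  by apply: add_submodule => //; apply: cyclic_submodule.
apply/seteqP; split=> [_ [a _ [y sy <-]]|_ [_ [a _ <-] [y sy <-]]].
  by exists (a *: x); [exists a | exists y].
by exists a => //; exists y.
Qed.

Lemma span_sum (s : seq M) (c : 'I_(size s) -> R) :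
  span s (\sum_(i < size s) c i *: s`_i).
Proof.
elim: s c => [|x s IHs] c /=; first by rewrite big_ord0.
by rewrite big_ord_recl; exists (c ord0) => //; exists (\sum_i c (lift ord0 i) *: s`_i).
Qed.

(** The generators are eliminated one at a time: if [t *: K] lies in the span of
[x :: s] then, as [K = I K], it even lies in [I x] plus the span of [s]; so
[(t - a) *: x] is in the span of [s] for some [a] in [I], and [(t - a) * t] maps
[K] into that span, while still being congruent to [1] modulo [I]. *)
Lemma nakayama (I : set R) (K : set M) (s : seq M) : ideal I ->
    K `<=` finite_sums [set a *: k | a in I & k in K] ->
    [set` s] `<=` K -> K `<=` span s ->
  exists2 a, I a & forall k, K k -> k = a *: k.
Proof.
move=> sI KIK sK Ks.
suff [t It tK] : exists2 t, I (1 - t) & forall k, K k -> t *: k = 0.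
  by exists (1 - t) => // k Kk; rewrite scalerBl scale1r tK ?subr0.
have : exists2 t, I (1 - t) & forall k, K k -> span s (t *: k).
  exists 1; first by rewrite subrr; apply: (ideal0 sI).
  by move=> k Kk; rewrite scale1r; apply: Ks.
elim: s sK {Ks} => [|x s IHs] sK [t It tK]; first by exists t.
apply: IHs => [y ys|]; first by apply: sK; rewrite /= inE; apply/orP; right.
pose Q := [set z | exists2 a, I a & span s (z - a *: x)].
have sQ : submodule Q.
  have ss := span_submodule s.
  apply/submoduleP; split.
  - exists 0; first exact: (ideal0 sI).
    by rewrite scale0r subr0; apply: submodule0.
  - move=> y z [a Ia sy] [b Ib sz]; exists (a + b); first exact: (idealD sI).
    by rewrite scalerDl opprD addrACA; apply: submoduleD.
  - move=> c y [a Ia sy]; exists (c * a); first exact: (idealM sI).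
    by rewrite -scalerA -scalerBr; apply: submoduleZ.
have KQ : K `<=` colon_elt Q t.
  apply: subset_trans KIK _; apply: finite_sums_min; first exact: colon_elt_submodule.
  move=> _ [a Ia [k Kk <-]]; have [b _ [y sy yE]] := tK _ Kk.
  exists (b * a); first exact: (idealM sI).
  rewrite scalerA mulrC -scalerA -yE scalerDr scalerA mulrC addrAC subrr add0r.
  exact: submoduleZ (span_submodule s) sy.
have Kx : K x by apply: sK; rewrite /= inE eqxx.
have [a Ia sa] := KQ _ Kx.
exists ((t - a) * t).
  have -> : 1 - (t - a) * t = (1 - t) + (t * (1 - t) + t * a) by ring.
  by apply: (idealD sI) => //; apply: (idealD sI); apply: (idealM sI).
move=> k Kk; have [b Ib sb] := KQ _ Kk.
rewrite -scalerA -[t *: k](subrK (b *: x)) scalerDr.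
apply: submoduleD (span_submodule s) _ _.
  exact: submoduleZ (span_submodule s) sb.
rewrite scalerA mulrC -scalerA; apply: submoduleZ (span_submodule s) _.
by rewrite scalerBl.
Qed.

End Nakayama.

(** * Coreduced modules and regular rings *)

Section Regularity.
Variables (R : comPzRingType) (M : lmodType R).
Implicit Types (x : M) (r : R).

(** If [r *: x] were outside [r * r *: M], some completely irreducible [L] would
contain the latter but not the former.  The residual of [L] by [r] is again
completely irreducible and contains [r *: M], so coreducedness makes it and the
annihilator of [r] span [M]; since it contains that annihilator, it is [M], and [r *: x] is in [L]
after all. *)
Lemma coreduced_scale_sqr r x : coreduced M ->
  exists y : M, r *: x = (r * r) *: y.
Proof.
move=> cored; pose N : set M := range (fun y => (r * r) *: y).
have sN : submodule N.
  apply/submoduleP; split; first by exists 0; rewrite // scaler0.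
    by move=> _ _ [y _ <-] [z _ <-]; exists (y + z); rewrite // scalerDr.
  by move=> a _ [y _ <-]; exists (a *: y); rewrite // !scalerA mulrC.
have [[y _ yE]|Nrx] := pselect (N (r *: x)); first by exists y.
have [L NL maxL] := exists_maximal_avoiding sN Nrx.
have maxLr := maximal_avoiding_colon_elt maxL.
have ciLr := maximal_avoiding_completely_irreducible maxLr.
have LrrT : colon_elt (colon_elt L r) r = setT.
  apply/seteqP; split=> // y _; apply: NL.
  by exists y; rewrite // scalerA.
have [sLr Lrx _] := maxLr; exfalso; apply: Lrx.
have : [set u + v | u in colon_elt L r & v in colon_elt [set 0] r] x.
  by rewrite (cored _ _ ciLr LrrT).
move=> [u Lu [v v0 <-]]; apply: submoduleD => //.
have {}v0 : r *: v = 0 by [].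
by rewrite /colon_elt /= v0; apply: submodule0; case: maxL.
Qed.

Lemma finitely_generated_span : finitely_generated M ->
  exists s : seq M, forall x, span s x.
Proof. by case=> s sM; exists s => x; have [c ->] := sM x; apply: span_sum. Qed.

(** Nakayama's lemma for the finitely generated module [r *: M] and the ideal
generated by [r] gives [s] with [r = r * r * s] on [M], hence in [R]. *)
Lemma faithful_coreduced_regular :
    finitely_generated M -> faithful M -> coreduced M ->
  forall r, exists s, r = r * r * s.
Proof.
move=> fg faith cored r; have [s sM] := finitely_generated_span fg.
pose I : set R := range (fun a => a * r).
have sI : ideal I.
  apply/submoduleP; split; first by exists 0; rewrite // mul0r.
    by move=> _ _ [a _ <-] [b _ <-]; exists (a + b); rewrite // mulrDl.
  by move=> a _ [b _ <-]; exists (a * b); rewrite // -mulrA.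
pose K : set M := range (fun x => r *: x).
have [|||_ [a _ <-] aK] := @nakayama R M I K [seq r *: x | x <- s] sI.
- move=> _ [x _ <-]; have [y ->] := coreduced_scale_sqr r x cored.
  apply: finite_sums_gen; exists r; first by exists 1; rewrite // mul1r.
  by exists (r *: y); [exists y | rewrite scalerA].
- by move=> _ /mapP[x _ ->]; exists x.
- move=> _ [x _ <-]; move: (sM x) => {sM}; elim: s x => [x ->|y s IHs x] /=.
    by rewrite scaler0.
  move=> [c _ [z /IHs rz <-]]; exists c => //; exists (r *: z) => //.
  by rewrite scalerDr !scalerA mulrC.
exists a; apply/eqP; rewrite -subr_eq0; apply/eqP/faith => x.
have rxE : r *: x = (a * r) *: (r *: x) by apply: aK; exists x.
by rewrite scalerBl {1}rxE scalerA -mulrA [a * _]mulrC subrr.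
Qed.

End Regularity.

(** * Maximal ideals and second submodules *)

Section Semisimplicity.
Variables (R : comPzRingType) (M : lmodType R).
Hypotheses (fg : finitely_generated M) (faith : faithful M).
Hypotheses (comult : comultiplication M).
Hypothesis regular : forall r : R, exists s, r = r * r * s.
Implicit Types (m : set R) (K L N : set M) (x : M) (a r : R).

(** By Nakayama's lemma [m *: M] is proper, so comultiplication provides a nonzero
[r] killing it, and faithfulness gives [r * m = 0]; were [r] in [m], then
[r * r] would vanish and, by regularity, [r] as well. *)
Lemma proper_ideal_annihilator m : ideal m -> ~ m 1 ->
  exists2 r, ~ m r & forall a, m a -> r * a = 0.
Proof.
move=> sm m1; have [J sJ mME] := comult (ideal_mul_submodule sm M).
have [r Jr r0] : exists2 r, J r & r <> 0.
  apply: contrapT => J0; have [s sM] := finitely_generated_span fg.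
  have {}J0 r : J r -> r = 0 by move=> Jr; apply: contrapT => r0; apply: J0; exists r.
  have mMT x : ideal_mul M m x by rewrite mME => a /J0 ->; rewrite scale0r.
  have [|||a ma a1] := @nakayama R M m setT s sm => //.
    by move=> x _; apply: mMT.
  apply: m1; suff -> : 1 = a by [].
  apply/eqP; rewrite -subr_eq0; apply/eqP/faith => x.
  by rewrite scalerBl scale1r -a1 ?subrr.
have rm a : m a -> r * a = 0.
  move=> ma; apply: faith => x.
  have : ideal_mul M m (a *: x) by apply: finite_sums_gen; exists a => //; exists x.
  by rewrite mME => /(_ r Jr) /=; rewrite scalerA.
exists r => // mr; apply: r0; have [s ->] := regular r.
by rewrite rm // mul0r.
Qed.

(** The cyclic submodule of [x] is a vector space over the field [R / m]. *)
Lemma second_cyclic m x : @maximal_avoiding R R^o 1 m -> x <> 0 ->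
  (forall a, m a -> a *: x = 0) -> second (range ( *:%R^~ x)).
Proof.
move=> [sm m1 maxm] x0 mx; split; first exact: cyclic_submodule.
  by move=> Rx0; apply: x0; have : [set 0] x by rewrite -Rx0; exists 1; rewrite // scale1r.
move=> a; have [ma|ma] := pselect (m a).
  by right=> _ [b _ <-]; rewrite scalerA mulrC -scalerA mx // scaler0.
left; pose P : set R^o := [set y + z | y in m & z in range (fun b : R => b * a)].
have sP : @submodule R R^o P.
  by apply: add_submodule => //; apply: cyclic_submodule.
have [y my [_ [c _ <-] yE]] : P 1.
  apply: contrapT => P1; apply: ma; apply: (maxm P) => //.
    move=> y my; exists y => //; exists 0; last by rewrite addr0.
    by exists 0; rewrite // mul0r.
  exists 0; first exact: (submodule0 sm).
  by exists a; [exists 1; rewrite // mul1r | rewrite add0r].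
have {yE}ca : c * a = 1 - y by rewrite -yE addrC addKr.
move=> _ [b _ <-]; exists ((b * c) *: x); first by exists (b * c).
by rewrite scalerA mulrC -mulrA ca mulrBr mulr1 scalerBl -scalerA (mx y) // scaler0 subr0.
Qed.

(** For [x] in [K], the ideal of the [r] with [r *: x] in [sec K] is everything:
otherwise it lies in a maximal ideal [m], which is annihilated by some [r] outside
[m]; but then [r *: x] is killed by [m], hence lies in a second submodule of
[K], and [r] belongs to that ideal after all. *)
Lemma sec_id K : submodule K -> sec K = K.
Proof.
move=> sK; apply/seteqP; split.
  by apply: finite_sums_min => // x [N [_ NK] Nx]; apply: NK.
move=> x Kx; pose A : set R^o := [set r : R | sec K (r *: x)].
have sS := sec_submodule K.
have sA : @submodule R R^o A.
  apply/submoduleP; split; rewrite /A /=.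
  - by rewrite scale0r; apply: submodule0.
  - by move=> a b Sa Sb; rewrite scalerDl; apply: submoduleD.
  - by move=> a b Sb; rewrite -scalerA; apply: submoduleZ.
have [|A1] := pselect (A 1); first by rewrite /A /= scale1r.
have [m Am maxm] := @exists_maximal_avoiding R R^o A 1 sA A1.
have [sm m1 _] := maxm.
have [r mr rm] := proper_ideal_annihilator sm m1.
exfalso; apply: mr; apply: Am; rewrite /A /=.
have [->|rx0] := pselect (r *: x = 0); first exact: submodule0.
apply: finite_sums_gen; exists (range ( *:%R^~ (r *: x))); last first.
  by exists 1; rewrite // scale1r.
split.
  apply: (second_cyclic maxm) => // a ma.
  by rewrite scalerA mulrC rm // scale0r.
by move=> _ [a _ <-]; do 2!apply: submoduleZ => //.
Qed.

(** If [N] lies in a second submodule [L], every [a] killing [N] kills [L]: else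
[a] maps [L] onto itself, so the idempotent [a * s], where [a = a * a * s], acts
as the identity on [L], whence [N = s *: (a *: N) = 0].  As [N] is the submodule
killed by its annihilator, [L] lies in [N]. *)
Lemma second_maximal_second N : second N -> maximal_second N.
Proof.
move=> secN; split=> // -[L [sL L0 aL] [NL LN]]; apply: LN => l Ll.
have [sN N0 _] := secN; have [J sJ NE] := comult sN.
rewrite NE => a Ja /=.
have aN n : N n -> a *: n = 0 by rewrite NE => /(_ a Ja).
case: (aL a) => [surj|]; last exact.
exfalso; apply: N0; apply/seteqP; split=> [n Nn|_ ->]; last exact: submodule0.
have [y Ly yE] := surj _ (NL _ Nn); have [s aE] := regular a.
have nE : n = s *: (a *: n).
  by rewrite -yE !scalerA {1}aE; congr (_ *: _); ring.
by rewrite /= nE aN // scaler0.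
Qed.

Lemma max_sec_sec K : max_sec K = sec K.
Proof.
congr sum_submodules; apply/seteqP; split=> N [].
  by case=> secN _ NK.
by move=> /second_maximal_second.
Qed.

End Semisimplicity.

Theorem theorem2p17 (R : comPzRingType) (M : lmodType R)
    (hfg : finitely_generated M) (hfaith : faithful M)
    (hcored : coreduced M) (hcomult : comultiplication M)
    (I : set R) (hI : ideal I) :
  max_sec (ideal_mul M I) = sec (ideal_mul M I) /\
  sec (ideal_mul M I) = ideal_mul M I.
Proof.
have regular := faithful_coreduced_regular hfg hfaith hcored.
split; first exact: max_sec_sec.
exact: sec_id (ideal_mul_submodule hI M).
Qed.
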